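(* Let $(X,d)$ be a compact metric space and let $T_1,\dots,T_k\colon X\to X$ ($k\ge 2$) be continuous maps such that the set $S_{\mathrm t}$ of weakly hyperbolic sequences of $\mathrm{IFS}(T_1,\dots,T_k)$ is non-empty. Let $A_{\mathrm t}$ be the target set. Then $\overline{A_{\mathrm t}}$ is a Conley attractor of the IFS if and only if it is a strict attractor of the IFS.
   Context: $\mathrm{IFS}(T_1,\dots,T_k)$ denotes the iterated function system formed by the continuous maps $T_1,\dots,T_k$ of the compact metric space $X$. Its Barnsley-Hutchinson operator is $\mathcal B(A)=\bigcup_{i=1}^k T_i(A)$ for $A\subset X$. $\mathcal H(X)$ is the set of non-empty compact subsets of $X$ with the Hausdorff distance; limits of compact sets are taken in this distance. $\Sigma_k^+=\{1,\dots,k\}^{\mathbb N}$, with sequences $\xi=\xi_0\xi_1\xi_2\dots$. The set of weakly hyperbolic sequences is $S_{\mathrm t}=\{\xi\in\Sigma_k^+ : \lim_{n\to\infty}\mathrm{diam}(T_{\xi_0}\circ\cdots\circ T_{\xi_n}(X))=0\}$. The coding map $\pi\colon S_{\mathrm t}\to X$ is $\pi(\xi)=\lim_{n\to\infty}T_{\xi_0}\circ\cdots\circ T_{\xi_n}(p)$, which does not depend on $p\in X$. The target set is $A_{\mathrm t}=\pi(S_{\mathrm t})$. A compact set $S\in\mathcal H(X)$ is a Conley attractor if there is an open neighbourhood $U$ of $S$ with $\lim_{n\to\infty}\mathcal B^n(\overline U)=S$. A compact set $A\in\mathcal H(X)$ is a strict attractor if there is an open neighbourhood $U$ of $A$ such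 that $\lim_{n\to\infty}\mathcal B^n(K)=A$ for every non-empty compact set $K\subset U$. *)

(* Defs.v *)
From HB Require Import structures.
From mathcomp Require Import all_boot all_order all_algebra.
From mathcomp Require Import all_classical all_reals all_analysis.

Set Implicit Arguments.
Unset Strict Implicit.
Unset Printing Implicit Defensive.

Import Order.TTheory GRing.Theory Num.Theory.
Import numFieldNormedType.Exports.

Local Open Scope classical_set_scope.
Local Open Scope ring_scope.

(* The functions [sup] and [inf] below are real-valued, hence meaningful only
   on non-empty bounded sets of reals; in a compact space every set of
   distances is bounded (see [compact_mdist_bounded]). *)

Definition diam (R : realType) (X : metricType R) (A : set X) : R :=
  sup [set mdist z.1 z.2 | z in A `*` A].

Definition dist_to (R : realType) (X : metricType R) (x : X) (B : set X) : R :=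
  inf [set mdist x b | b in B].

Definition hausdorff_dist (R : realType) (X : metricType R) (A B : set X) : R :=
  Num.max (sup [set dist_to a B | a in A]) (sup [set dist_to b A | b in B]).

Definition hausdorff_cvg (R : realType) (X : metricType R)
    (u : nat -> set X) (A : set X) : Prop :=
  hausdorff_dist (u n) A @[n --> \oo] --> (0 : R).

(* The hyperspace of non-empty compact sets. *)
Definition hyperspace (R : realType) (X : metricType R) : set (set X) :=
  [set A | A !=set0 /\ compact A].

Definition barnsley_hutchinson (X : Type) (k : nat) (T : 'I_k -> X -> X)
    (A : set X) : set X :=
  \bigcup_(i in [set: 'I_k]) (T i @` A).

(* T_(xi 0) \o ... \o T_(xi n): there are n + 1 factors, and the new ones are
   added on the right (innermost). *)
Fixpoint comp_word (X : Type) (k : nat) (T : 'I_k -> X -> X)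
    (xi : nat -> 'I_k) (n : nat) : X -> X :=
  if n is m.+1 then comp_word T xi m \o T (xi n) else T (xi 0%N).

Definition weakly_hyperbolic (R : realType) (X : metricType R) (k : nat)
    (T : 'I_k -> X -> X) : set (nat -> 'I_k) :=
  [set xi | diam (range (comp_word T xi n)) @[n --> \oo] --> (0 : R)].

(* The graph of the coding map: [coding T xi x] says that x is the limit of
   T_(xi 0) \o ... \o T_(xi n) (p) whatever the point p. On weakly hyperbolic
   sequences it is functional and total: see [coding_fun]. *)
Definition coding (R : realType) (X : metricType R) (k : nat)
    (T : 'I_k -> X -> X) (xi : nat -> 'I_k) (x : X) : Prop :=
  forall p : X, comp_word T xi n p @[n --> \oo] --> x.

Definition target_set (R : realType) (X : metricType R) (k : nat)
    (T : 'I_k -> X -> X) : set X :=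
  [set x | exists2 xi, weakly_hyperbolic T xi & coding T xi x].

Definition conley_attractor (R : realType) (X : metricType R) (k : nat)
    (T : 'I_k -> X -> X) (S : set X) : Prop :=
  hyperspace S /\
  exists U : set X, [/\ open U, S `<=` U &
    hausdorff_cvg (fun n => iter n (barnsley_hutchinson T) (closure U)) S].

Definition strict_attractor (R : realType) (X : metricType R) (k : nat)
    (T : 'I_k -> X -> X) (A : set X) : Prop :=
  hyperspace A /\
  exists U : set X, [/\ open U, A `<=` U &
    forall K : set X, hyperspace K -> K `<=` U ->
      hausdorff_cvg (fun n => iter n (barnsley_hutchinson T) K) A].

Lemma compact_mdist_bounded (R : realType) (X : metricType R) :
  compact [set: X] -> exists M : R, forall x y : X, mdist x y <= M.
Proof.
move=> cX; have [[p _]|X0] := pselect ([set: X] !=set0); last first.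
  by exists 0 => x; exfalso; apply: X0; exists x.
move: cX; rewrite compact_near_coveringP => cX.
have [x _|M [_ HM]] :=
    cX R (pinfty_nbhs R) (fun (M : R) (y : X) => mdist p y < M) _.
  exists (ball x 1, [set M : R | mdist p x + 1 < M]).
    by split=> /=; [exact: nbhsx_ballx ltr01 | exact: nbhs_pinfty_gt (num_real _)].
  move=> [z M] /= [xz xM]; apply: le_lt_trans xM.
  rewrite (le_trans (metric_triangle p x z))// lerD2l ltW//.
  by move: xz; rewrite ballEmdist.
have {}HM y : mdist p y < M + 1 by apply: HM => //; rewrite ltrDl.
exists ((M + 1) + (M + 1)) => x y.
rewrite (le_trans (metric_triangle x p y))// lerD// ltW//.
by rewrite metric_sym.
Qed.

Lemma mdist_le_diam (R : realType) (X : metricType R) (A : set X) (x y : X) :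
  compact [set: X] -> A x -> A y -> mdist x y <= diam A.
Proof.
move=> /compact_mdist_bounded[M HM] Ax Ay; apply: ub_le_sup.
  by exists M => _ [z _ <-]; exact: HM.
by exists (x, y).
Qed.

Lemma range_comp_word (X : Type) (k : nat) (T : 'I_k -> X -> X)
    (xi : nat -> 'I_k) (n m : nat) : (n <= m)%N ->
  range (comp_word T xi m) `<=` range (comp_word T xi n).
Proof.
move=> /subnK <-; elim: (m - n)%N => [|j IH] //.
by apply: subset_trans IH => _ [z _ <-]; exists (T (xi (j + n).+1) z).
Qed.

Lemma coding_fun (R : realType) (X : metricType R) (k : nat)
    (T : 'I_k -> X -> X) (xi : nat -> 'I_k) :
  compact [set: X] -> [set: X] !=set0 -> weakly_hyperbolic T xi ->
  exists! x, coding T xi x.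
Proof.
move=> cX [p _] xiS.
have [x [_ clx]] := cX (comp_word T xi n p @[n --> \oo]) _ filterT.
have cvx : coding T xi x.
  move=> q; apply/metricType_numDomainType.cvgrPdist_lt => e e0.
  have e20 : 0 < e / 2 by rewrite divr_gt0.
  have [N _ HN] : \forall n \near \oo,
      diam (range (comp_word T xi n)) < e / 2.
    by move/cvgr_lt : xiS; apply.
  have [] := clx (comp_word T xi ^~ p @` [set m | (N <= m)%N]) (ball x (e / 2)).
  - by exists N => // m /= Nm; exists m.
  - exact: nbhsx_ballx.
  move=> _ [[m /= Nm <-]]; rewrite ballEmdist /= => xm.
  exists N => // n /= Nn; rewrite (le_lt_trans (metric_triangle _ (comp_word T xi m p) _))//.
  rewrite [e]splitr ltrD// (le_lt_trans _ (HN N _))//=.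
  by apply: mdist_le_diam => //; [exact: (range_comp_word Nm)|
    exact: (range_comp_word Nn)].
exists x; split=> // y cy.
exact: (cvg_unique (@metric_hausdorff _ X) (cvx p) (cy p)).
Qed.

(* Main.v *)
Require Import Defs.
From HB Require Import structures.
From mathcomp Require Import all_boot all_order all_algebra.
From mathcomp Require Import all_classical all_reals all_analysis.
From mathcomp Require Import lra.

(** Convergence in the Hausdorff distance splits into two one-sided conditions
    ([hausdorff_cvgP]): for every e > 0, eventually the iterates lie within e
    of the limit, and the limit lies within e of the iterates.

    For the closure of the target set, the second condition always holds,
    whatever the non-empty starting set K ([closure_target_set_near]). Indeed,
    if p is in K and xi is weakly hyperbolic, the point coded by xi is the limit
    of the points T_(xi 0) \o ... \o T_(xi n) (p), which belong to the iterates
    of K; hence every target point is approached by the iterates, and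
    compactness makes the approach uniform.

    Conley implies strict, with the same U: the first condition is monotone in
    the starting set, so it passes from the closure of U to any compact K inside
    U. Strict implies Conley by normality: the attractor has an open
    neighbourhood W whose closure is inside U, and this closure is one of the
    compact sets to which the strict attraction applies. *)

Import Order.TTheory GRing.Theory Num.Theory.
Import numFieldNormedType.Exports.

Local Open Scope classical_set_scope.
Local Open Scope ring_scope.

Definition thickening {R : realType} {X : metricType R} (e : R) (B : set X) :
  set X := \bigcup_(b in B) ball b e.

Lemma dist_to_ge0 {R : realType} {X : metricType R} (x : X) (B : set X) :
  B !=set0 -> 0 <= dist_to x B.
Proof.
move=> [b Bb]; apply: lb_le_inf; first by exists (mdist x b), b.
by move=> _ [c _ <-]; exact: mdist_ge0.
Qed.

Lemma dist_to_le {R : realType} {X : metricType R} (x b : X) (B : set X) :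
  B b -> dist_to x B <= mdist x b.
Proof.
move=> Bb; apply: ge_inf; last by exists b.
by exists 0 => _ [c _ <-]; exact: mdist_ge0.
Qed.

Lemma dist_to_lt_thickening {R : realType} {X : metricType R} (e : R) (x : X)
    (B : set X) : B !=set0 -> dist_to x B < e -> thickening e B x.
Proof.
move=> [b Bb] /inf_lt[|_ [c Bc <-] xc]; first by exists (mdist x b), b.
by exists c => //; rewrite ballEmdist /= metric_sym.
Qed.

Lemma thickening_dist_to_lt {R : realType} {X : metricType R} (e : R) (x : X)
    (B : set X) : thickening e B x -> dist_to x B < e.
Proof.
move=> [b Bb]; rewrite ballEmdist /= metric_sym.
exact/le_lt_trans/dist_to_le.
Qed.

(** Compactness of the space bounds the set of distances, without which [sup]
    would take a default value. *)
Lemma dist_to_le_sup {R : realType} {X : metricType R} (A B : set X) (a : X) :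
  compact [set: X] -> B !=set0 -> A a ->
  dist_to a B <= sup [set dist_to a B | a in A].
Proof.
move=> /compact_mdist_bounded[M HM] [b Bb] Aa.
apply: ub_le_sup; last by exists a.
by exists M => _ [c _ <-]; exact: le_trans (dist_to_le c b B Bb) (HM c b).
Qed.

Lemma sup_dist_to_lt_thickening {R : realType} {X : metricType R} (e : R)
    (A B : set X) : compact [set: X] -> B !=set0 ->
  sup [set dist_to a B | a in A] < e -> A `<=` thickening e B.
Proof.
move=> cX B0 ABe a Aa; apply: dist_to_lt_thickening => //.
exact: le_lt_trans (dist_to_le_sup A B a cX B0 Aa) ABe.
Qed.

Lemma thickening_sup_dist_to_le {R : realType} {X : metricType R} (e : R)
    (A B : set X) : A !=set0 -> A `<=` thickening e B ->
  sup [set dist_to a B | a in A] <= e.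
Proof.
move=> [a Aa] AB; apply: ge_sup; first by exists (dist_to a B), a.
by move=> _ [c Ac <-]; exact/ltW/thickening_dist_to_lt/AB.
Qed.

Lemma hausdorff_dist_ge0 {R : realType} {X : metricType R} (A B : set X) :
  compact [set: X] -> A !=set0 -> B !=set0 -> 0 <= hausdorff_dist A B.
Proof.
move=> cX [a Aa] B0; rewrite le_max; apply/orP; left.
exact: le_trans (dist_to_ge0 a B B0) (dist_to_le_sup A B a cX B0 Aa).
Qed.

(** The two inclusions are kept apart because they are proved differently: the
    first is inherited by smaller sets [u n], the second is automatic for the
    iterates of the operator and the closure of the target set. *)
Lemma hausdorff_cvgP {R : realType} {X : metricType R} (u : nat -> set X)
    (A : set X) : compact [set: X] -> (forall n, u n !=set0) -> A !=set0 ->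
  hausdorff_cvg u A <-> forall e : R, 0 < e -> \forall n \near \oo,
    u n `<=` thickening e A /\ A `<=` thickening e (u n).
Proof.
move=> cX u0 A0; split=> [uA e e0|uA].
  move/cvgr_lt : uA => /(_ e e0).
  apply: filterS => n; rewrite gt_max => /andP[un An].
  by split; exact: sup_dist_to_lt_thickening.
apply/(cvgr0Pnorm_le (V := R)) => e e0; apply: filterS (uA _ e0) => n [un An].
rewrite ger0_norm ?ge_max; last exact: hausdorff_dist_ge0.
by rewrite !thickening_sup_dist_to_le.
Qed.

Lemma barnsley_hutchinson_neq0 {X : Type} {k : nat} (T : 'I_k -> X -> X)
    (i : 'I_k) (K : set X) (n : nat) :
  K !=set0 -> iter n (barnsley_hutchinson T) K !=set0.
Proof.
move=> K0; elim: n => [//|n [x Kx]].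
by exists (T i x); exists i => //; exists x.
Qed.

Lemma iter_barnsley_hutchinson_subset {X : Type} {k : nat}
    (T : 'I_k -> X -> X) (K L : set X) (n : nat) : K `<=` L ->
  iter n (barnsley_hutchinson T) K `<=` iter n (barnsley_hutchinson T) L.
Proof.
by move=> KL; elim: n => //= n IH; apply: subset_bigcup => i _; exact: image_subset.
Qed.

(** A word of index [n] has [n.+1] letters, hence the iterate [n.+1]. As new
    letters are innermost, the induction changes the starting set: the innermost
    letter sends [K] into its image by the operator. *)
Lemma comp_word_barnsley_hutchinson {X : Type} {k : nat} (T : 'I_k -> X -> X)
    (xi : nat -> 'I_k) (n : nat) (K : set X) (p : X) : K p ->
  iter n.+1 (barnsley_hutchinson T) K (comp_word T xi n p).
Proof.
elim: n K p => [|n IH] K p Kp; first by exists (xi 0%N) => //; exists p.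
by rewrite iterSr; apply: IH; exists (xi n.+1) => //; exists p.
Qed.

(** A point x of the closure has a target point a near it, and the iterates of
    one point p of [K] along a code of a converge to a. So the points close to x
    are eventually close to the iterates of [K], by the triangle inequality
    through x and a; a near-covering argument gives a rank common to all x. *)
Lemma closure_target_set_near {R : realType} {X : metricType R} {k : nat}
    (T : 'I_k -> X -> X) (K : set X) (e : R) : compact [set: X] ->
  K !=set0 -> 0 < e -> \forall n \near \oo, closure (target_set T) `<=`
    thickening e (iter n (barnsley_hutchinson T) K).
Proof.
move=> cX [p Kp] e0.
have /compact_near_coveringP cA : compact (closure (target_set T)).
  exact: subclosed_compact (@closed_closure _ _) cX (@subsetT _ _).
apply: (cA nat \oo (fun n x => thickening e
  (iter n (barnsley_hutchinson T) K) x)) => x clx.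
have e30 : 0 < e / 3 by rewrite divr_gt0.
have [a [[xi _ xia] xa]] := clx _ (nbhsx_ballx x _ e30).
have [N _ HN] : \forall n \near \oo, ball a (e / 3) (comp_word T xi n p).
  by apply: (xia p); exact: nbhsx_ballx.
(* Strictly above N, since the word of index n lies in the iterate n.+1. *)
exists (ball x (e / 3), [set n | (N < n)%N]).
  by split; [exact: nbhsx_ballx|exists N.+1].
case=> y [|n] /= [xy Nn]; first by rewrite ltn0 in Nn.
exists (comp_word T xi n p).
  exact: comp_word_barnsley_hutchinson.
have := HN n Nn; move: xa xy; rewrite !ballEmdist /= => xa xy an.
apply: le_lt_trans (metric_triangle _ a _) _.
have := metric_triangle a x y.
rewrite [mdist _ a]metric_sym [mdist a x]metric_sym => ay.
lra.
Qed.

Theorem theorem1 (R : realType) (X : metricType R) (cX : compact [set: X])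
    (k : nat) (hk : (2 <= k)%N) (T : 'I_k -> X -> X)
    (hT : forall i : 'I_k, continuous (T i))
    (hS : weakly_hyperbolic T !=set0) :
  conley_attractor T (closure (target_set T)) <->
  strict_attractor T (closure (target_set T)).
Proof.
have i0 : 'I_k := Ordinal (ltnW hk).
split=> -[hA [U [oU AU HU]]]; split=> //; have A0 := hA.1.
  exists U; split=> // K [K0 _] KU.
  have KclU : K `<=` closure U := subset_trans KU (@subset_closure _ _).
  have clU0 : closure U !=set0 by case: K0 => x /KclU; exists x.
  apply/hausdorff_cvgP => // [n|e e0]; first exact: barnsley_hutchinson_neq0.
  have Bn0 n := barnsley_hutchinson_neq0 T i0 _ n clU0.
  have /hausdorff_cvgP HU' := HU.
  have {HU'}BU := HU' cX Bn0 A0 e e0.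
  have AK := closure_target_set_near T K e cX K0 e0.
  apply: filterS2 BU AK => n [BU _] AK; split=> //.
  exact: subset_trans (iter_barnsley_hutchinson_subset T _ _ n KclU) BU.
have [V /set_nbhsP[W [oW AW WV]] VU] :
    filter_from (set_nbhs (closure (target_set T))) closure U.
  apply: (@pseudometric_normal R X _ (@closed_closure _ _)).
  by apply/set_nbhsP; exists U; split.
have WU := subset_trans (closure_subset WV) VU.
exists W; split=> //; apply: HU => //; split.
  by case: A0 => x /AW Wx; exists x; exact: subset_closure.
exact: subclosed_compact (@closed_closure _ _) cX (@subsetT _ _).
Qed.
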